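(* Let $(X,d)$ be a metric space, let $M$ be a nonempty proper closed subset of $X$, let $F:(X\setminus M,d)\to(0,\infty)$ be a $1$-Lipschitz function, and let $j$ be the metric on $X\setminus M$ defined by $$j(x,y)=\frac12\log\left[\left(1+\frac{d(x,y)}{F(x)}\right)\left(1+\frac{d(x,y)}{F(y)}\right)\right],\qquad x,y\in X\setminus M.$$ Then the identity map $1_{X\setminus M}:(X\setminus M,d)\to(X\setminus M,j)$ is $1$-quasiconformal.
   Context: $\log$ is the natural logarithm. $F$ is $1$-Lipschitz if $|F(x)-F(y)|\le d(x,y)$ for all $x,y\in X\setminus M$. The function $j$ is a metric on $X\setminus M$. For a homeomorphism $f:(Y,\rho)\to(Z,\sigma)$ between metric spaces, $x\in Y$ and $r>0$, set $$H_f(x,r)=\frac{\sup\{\sigma(f(x),f(y)):y\in Y,\ \rho(x,y)\le r\}}{\inf\{\sigma(f(x),f(y)):y\in Y,\ \rho(x,y)\ge r\}}$$ (with $\inf\emptyset=+\infty$, and the quotient understood as $0$ in that case when the numerator is finite). For a constant $0\le H<\infty$, a map $f:(Y,\rho)\to(Z,\sigma)$ is $H$-quasiconformal if it is a homeomorphism and $\limsup_{r\to0}H_f(x,r)\le H$ for every $x\in Y$. *)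

(* Defs.v *)
From HB Require Import structures.
From mathcomp Require Import all_boot all_order all_algebra.
From mathcomp Require Import all_classical all_reals all_analysis.
From mathcomp Require Import ring lra.

Set Implicit Arguments.
Unset Strict Implicit.
Unset Printing Implicit Defensive.

Import Order.TTheory GRing.Theory Num.Theory.
Import numFieldNormedType.Exports.

Local Open Scope classical_set_scope.
Local Open Scope ring_scope.

(* The library already equips [set_type A] with the pseudometric induced by
   that of [X]; this makes it a metric space, with the restricted distance. *)
Section subtype_metric.
Context {R : realType} {X : metricType R} (A : set X).

Let dist (x y : A) : R := mdist (\val x) (\val y).

Let dist_ge0 x y : 0 <= dist x y.
Proof. exact: mdist_ge0. Qed.

Let dist_positivity x y : dist x y = 0 -> x = y.
Proof. by move=> /mdist_positivity /val_inj. Qed.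

Let ballEdist (x : A) (e : R) : ball x e = [set y | dist x y < e].
Proof.
rewrite -(initial_ballE (f := set_val)).
by apply/seteqP; split => y; rewrite /preimage/= ballEmdist.
Qed.

HB.instance Definition _ := @PseudoMetric_isMetric.Build R (set_type A)
  dist dist_ge0 dist_positivity ballEdist.

End subtype_metric.

Lemma mdist_subtype (R : realType) (X : metricType R) (A : set X) (x y : A) :
  mdist x y = mdist (\val x) (\val y).
Proof. by []. Qed.

Section quasiconformal.
Context {R : realType} {Y Z : metricType R}.

Definition homeomorphism (f : Y -> Z) : Prop :=
  continuous f /\ exists2 g : Z -> Y, cancel f g /\ cancel g f & continuous g.

Local Open Scope ereal_scope.

(* In the library, [ereal_inf set0 = +oo], [x / +oo = 0] for all finite [x]
   and [x / 0 = +oo] for all [x > 0]. The library values of the remaining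
   quotients, [+oo / +oo] and [0 / 0], have no effect on the upper limit below:
   if [f] is a homeomorphism, then for small [r > 0] the numerator is finite
   (continuity of [f] at [x]), and the numerator and the denominator do not
   both vanish (if [x] is isolated, so is [f x]). *)
Definition dilatation (f : Y -> Z) (x : Y) (r : R) : \bar R :=
  ereal_sup [set (mdist (f x) (f y))%:E | y in [set y | (mdist x y <= r)%R]] /
  ereal_inf [set (mdist (f x) (f y))%:E | y in [set y | (r <= mdist x y)%R]].

Definition quasiconformal (H : R) (f : Y -> Z) : Prop :=
  homeomorphism f /\
  forall x : Y, limf_esup (dilatation f x) (0 : R)^'+ <= H%:E.

End quasiconformal.

Definition lipschitz1 {R : realType} {Y : metricType R} (F : Y -> R) : Prop :=
  forall x y, `|F x - F y| <= mdist x y.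

Definition jdist {R : realType} {Y : metricType R} (F : Y -> R) (x y : Y) : R :=
  2^-1 * ln ((1 + mdist x y / F x) * (1 + mdist x y / F y)).

(* The set [Y] with the distance [jdist F] instead of its original one; the
   hypotheses on [F] are parameters because [jdist F] is a metric only under
   them. *)
Definition jspace {R : realType} {Y : metricType R} (F : Y -> R)
  (Fpos : forall x, 0 < F x) (Flip : lipschitz1 F) : Type := Y.

Section jspace_metric.
Context {R : realType} {Y : metricType R} (F : Y -> R).
Hypotheses (Fpos : forall x, 0 < F x) (Flip : lipschitz1 F).

Let factor_ge1 (x y z : Y) : 1 <= 1 + mdist x y / F z.
Proof. by rewrite lerDl divr_ge0// ?mdist_ge0// ltW. Qed.

Let factor_gt0 (x y z : Y) : 0 < 1 + mdist x y / F z.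
Proof. exact: lt_le_trans ltr01 (factor_ge1 x y z). Qed.

Let jdistxx x : jdist F x x = 0.
Proof. by rewrite /jdist mdistxx !mul0r addr0 mulr1 ln1 mulr0. Qed.

Let jdist_sym x y : jdist F x y = jdist F y x.
Proof. by rewrite /jdist (metric_sym x y); congr (_ * ln _); exact: mulrC. Qed.

Let jdist_positivity x y : jdist F x y = 0 -> x = y.
Proof.
move=> /eqP; rewrite mulf_eq0 invr_eq0 pnatr_eq0/= => /eqP l0.
apply: mdist_positivity; apply/eqP; apply/negPn/negP => d0.
have d_gt0 : 0 < mdist x y by rewrite lt_neqAle eq_sym d0 mdist_ge0.
suff : 1 < (1 + mdist x y / F x) * (1 + mdist x y / F y).
  by move/ln_gt0; rewrite l0 ltxx.
apply: (@lt_le_trans _ _ (1 + mdist x y / F x)).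
  by rewrite ltrDl divr_gt0.
by rewrite ler_peMr// ltW.
Qed.

Let jdist_triangle y x z : jdist F x z <= jdist F x y + jdist F y z.
Proof.
rewrite /jdist -mulrDr ler_pM2l ?invr_gt0// -lnM ?posrE ?mulr_gt0//.
rewrite ler_ln ?posrE ?mulr_gt0//.
have := metric_triangle x y z.
have := mdist_ge0 x y; have := mdist_ge0 y z; have := mdist_ge0 x z.
have := Flip y x; have := Flip y z; rewrite (metric_sym y x).
move: (mdist x y) (mdist y z) (mdist x z) => a b c.
move=> /ler_normlP[_ yz] /ler_normlP[_ yx] c0 b0 a0 cab.
have := Fpos x; have := Fpos y; have := Fpos z.
move: (F x) (F y) (F z) yz yx => u v w vw vu w0 v0 u0.
have h1 : 1 + c / u <= (1 + a / u) * (1 + b / v).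
  have -> : (1 + a / u) * (1 + b / v) = (u + a) * (v + b) / (u * v).
    by field; rewrite !gt_eqF.
  have -> : 1 + c / u = (u + c) * v / (u * v) by field; rewrite !gt_eqF.
  by rewrite ler_pM2r ?invr_gt0 ?mulr_gt0//; nra.
have h2 : 1 + c / w <= (1 + a / v) * (1 + b / w).
  have -> : (1 + a / v) * (1 + b / w) = (v + a) * (w + b) / (v * w).
    by field; rewrite !gt_eqF.
  have -> : 1 + c / w = (w + c) * v / (v * w) by field; rewrite !gt_eqF.
  by rewrite ler_pM2r ?invr_gt0 ?mulr_gt0//; nra.
have -> : (1 + a / u) * (1 + a / v) * ((1 + b / v) * (1 + b / w)) =
  ((1 + a / u) * (1 + b / v)) * ((1 + a / v) * (1 + b / w)) by ring.
by apply: ler_pM => //; rewrite addr_ge0// divr_ge0// ltW.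
Qed.

HB.instance Definition _ := Choice.on (jspace Fpos Flip).

HB.instance Definition _ := @isMetric.Build R (jspace Fpos Flip)
  (jdist F) jdistxx jdist_positivity jdist_sym jdist_triangle.

End jspace_metric.

Lemma mdist_jspace (R : realType) (Y : metricType R) (F : Y -> R)
    (Fpos : forall x, 0 < F x) (Flip : lipschitz1 F) (x y : jspace Fpos Flip) :
  mdist x y = jdist F x y.
Proof. by []. Qed.

(* Main.v *)
Require Import Defs.
From mathcomp Require Import all_boot all_order all_algebra.
From mathcomp Require Import all_classical all_reals all_analysis.
From mathcomp Require Import ring lra.

Set Implicit Arguments.
Unset Strict Implicit.
Unset Printing Implicit Defensive.

Import Order.TTheory GRing.Theory Num.Theory.
Import numFieldNormedType.Exports.

Local Open Scope classical_set_scope.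
Local Open Scope ring_scope.

(** Why the identity is 1-quasiconformal.  Write [a = F x] and
    [d = mdist x y].  Since [F] is 1-Lipschitz, [a - d <= F y <= a + d], and
    replacing [F y] by these two bounds makes the product under the logarithm
    telescope:
      [ln ((a + 2 d) / a) <= 2 j(x, y) <= ln ((a + d) / (a - d))],
    the upper bound for [d < a].  With [1 - 1 / t <= ln t <= t - 1] this gives
      [d / (a + 2 d) <= j(x, y) <= d / (a - d)]
    ([jdist_ge], [jdist_le]).  So [j] is infinitesimally [d / a] near [x], with
    constants that depend on [x] only.  Both bounds tend to 0 with [d] and
    increase with it.  Hence the two metrics have the same topology, and the
    dilatation of the identity at [x] and [r < a] is at most
      [(r / (a - r)) / (r / (a + 2 r)) = (a + 2 r) / (a - r)],
    which tends to 1 as [r] tends to 0.  Nothing here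
    refers to an ambient space, so the argument is carried out on a metric
    space [Y] ([quasiconformal_jspace]), of which the complement of [M] with
    the restricted distance is an instance. *)

Lemma limf_esup_le (T : choiceType) (X : filteredType T) (R : realType)
    (f : X -> \bar R) (F : set (set X)) (c : R) :
  (forall e, 0 < e -> F [set t | (f t <= (c + e)%:E)%E]) ->
  (limf_esup f F <= c%:E)%E.
Proof.
move=> fle; apply/lee_addgt0Pr => e e0.
apply: ge_ereal_inf; exists (ereal_sup (f @` [set t | (f t <= (c + e)%:E)%E])).
  by exists [set t | (f t <= (c + e)%:E)%E] => //; exact: fle.
by apply: ge_ereal_sup => _ [t ft <-]; rewrite -EFinD.
Qed.

(** The positive lower bound [m] excludes the degenerate quotients; an infinite
    denominator only makes the left-hand side vanish. *)
Lemma dilatation_le (R : realType) (Y Z : metricType R) (f : Y -> Z) (x : Y)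
    (r s m : R) : 0 <= r -> 0 < m ->
  (forall y, mdist x y <= r -> mdist (f x) (f y) <= s) ->
  (forall y, r <= mdist x y -> m <= mdist (f x) (f y)) ->
  (dilatation f x r <= (s / m)%:E)%E.
Proof.
move=> r0 m0 fs fm; rewrite /dilatation EFinM.
set S := ereal_sup _; set I := ereal_inf _.
have S0 : (0 <= S)%E.
  apply: ereal_sup_ubound; exists x; first by rewrite /= mdistxx.
  by rewrite mdistxx.
have mI : (m%:E <= I)%E.
  by apply: le_ereal_inf_tmp => _ [y ry <-]; rewrite lee_fin fm.
have I0 : (0 <= I)%E by apply: le_trans mI; rewrite lee_fin ltW.
apply: lee_pmul => //; first by rewrite inve_ge0.
  by apply: ge_ereal_sup => _ [y yr <-]; rewrite lee_fin fs.
have -> : (m^-1%:E = m%:E^-1)%E by rewrite inver gt_eqF.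
by rewrite lee_pV2// inE// lee_fin ltW.
Qed.

(** [ln t <= t - 1] applied to [1 / t]. *)
Lemma ln_ge_1BV (R : realType) (t : R) : 0 < t -> 1 - t^-1 <= ln t.
Proof.
move=> t0; rewrite -lerN2 -lnV ?posrE// opprB.
have := @le_ln1Dx R (t^-1 - 1); rewrite [1 + _]addrC subrK; apply.
by rewrite ltrBrDr addNr invr_gt0.
Qed.

Section jdist_bounds.
Context {R : realType} {Y : metricType R} (F : Y -> R).
Hypotheses (Fpos : forall x, 0 < F x) (Flip : lipschitz1 F).

(** The factor [1 + d / b] decreases in [b = F y], and [b >= a - d]; at
    [b = a - d] the product is [1 + 2 d / (a - d)]. *)
Lemma jdist_le x y :
  mdist x y < F x -> jdist F x y <= mdist x y / (F x - mdist x y).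
Proof.
move=> da; rewrite /jdist.
have := Fpos x; have := Fpos y; have := mdist_ge0 x y.
have := Flip x y; move: da.
move: (mdist x y) (F x) (F y) => d a b da /ler_normlP[_ ab] d0 b0 a0.
have ad0 : 0 < a - d by rewrite subr_gt0.
have db : d / b <= d / (a - d).
  by rewrite ler_wpM2l// lef_pV2 ?posrE//; lra.
have da0 : 0 <= d / a by rewrite divr_ge0// ltW.
have db0 : 0 <= d / b by rewrite divr_ge0// ltW.
have le2 : (1 + d / a) * (1 + d / b) <= 1 + 2 * (d / (a - d)).
  have -> : 1 + 2 * (d / (a - d)) = (1 + d / a) * (1 + d / (a - d)).
    by field; rewrite !gt_eqF.
  by apply: ler_wpM2l; [rewrite addr_ge0|rewrite lerD2l].
have dd0 : 0 <= d / (a - d) by exact: le_trans db.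
rewrite [leLHS]mulrC ler_pdivrMr// [leRHS]mulrC.
apply: (@le_trans _ _ (ln (1 + 2 * (d / (a - d))))).
  rewrite ler_ln ?posrE//; last lra.
  by apply: mulr_gt0; lra.
by apply: le_ln1Dx; lra.
Qed.

(** As above with [b <= a + d]; at [b = a + d] the product is
    [(a + 2 d) / a]. *)
Lemma jdist_ge x y : mdist x y / (F x + 2 * mdist x y) <= jdist F x y.
Proof.
rewrite /jdist.
have := Fpos x; have := Fpos y; have := mdist_ge0 x y; have := Flip x y.
move: (mdist x y) (F x) (F y) => d a b /ler_normlP[ba _] d0 b0 a0.
have ad0 : 0 < a + d by lra.
have a2d0 : 0 < a + 2 * d by lra.
have db : d / (a + d) <= d / b.
  by rewrite ler_wpM2l// lef_pV2 ?posrE//; lra.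
have da0 : 0 <= d / a by rewrite divr_ge0// ltW.
have db0 : 0 <= d / b by rewrite divr_ge0// ltW.
have t0 : 0 < (a + 2 * d) / a by rewrite divr_gt0.
have le2 : (a + 2 * d) / a <= (1 + d / a) * (1 + d / b).
  have -> : (a + 2 * d) / a = (1 + d / a) * (1 + d / (a + d)).
    by field; rewrite !gt_eqF.
  by apply: ler_wpM2l; [rewrite addr_ge0|rewrite lerD2l].
rewrite [leRHS]mulrC ler_pdivlMr//.
apply: (@le_trans _ _ (ln ((a + 2 * d) / a))); last first.
  by rewrite ler_ln ?posrE// (lt_le_trans t0).
apply: le_trans (ln_ge_1BV t0).
rewrite le_eqVlt; apply/orP; left; apply/eqP.
by field; rewrite !gt_eqF.
Qed.

(** The radius [e * F x / (1 + e)] solves [d / (F x - d) = e]. *)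
Lemma continuous_to_jspace : continuous (fun x : Y => (x : jspace Fpos Flip)).
Proof.
move=> x; apply/cvg_ballP => e e0.
have e10 : 0 < 1 + e by rewrite addr_gt0.
apply/nbhs_ballP; exists (e * F x / (1 + e)) => /=.
  by rewrite !mulr_gt0 ?invr_gt0.
move=> y; rewrite !ballEmdist/= mdist_jspace ltr_pdivlMr// => dlt.
have dF : mdist x y < F x.
  have := Fpos x; have := mdist_ge0 x y => d0 a0.
  by rewrite -(ltr_pM2r e10); lra.
apply: (le_lt_trans (jdist_le dF)).
by rewrite ltr_pdivrMr ?subr_gt0//; lra.
Qed.

(** The radius [e / (F x + 2 e)] is the lower bound of [jdist_ge] at [d = e],
    and that bound is increasing in [d]. *)
Lemma continuous_from_jspace : continuous (fun x : jspace Fpos Flip => (x : Y)).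
Proof.
move=> x A /nbhs_ballP[e /= e0 eA].
have a0 := Fpos x.
have ae0 : 0 < F x + 2 * e by rewrite addr_gt0// mulr_gt0.
apply/(@nbhs_ballP R (jspace Fpos Flip)).
exists (e / (F x + 2 * e)) => /=; first exact: divr_gt0.
move=> y; rewrite ballEmdist/= mdist_jspace => jlt.
apply: eA; rewrite ballEmdist/=.
have := le_lt_trans (jdist_ge x y) jlt.
have d0 := @mdist_ge0 R Y x y.
have ad0 : 0 < F x + 2 * mdist (x : Y) y by lra.
rewrite ltr_pdivrMr// mulrAC ltr_pdivlMr// => h.
by rewrite -(ltr_pM2r a0); lra.
Qed.

(** Both bounds on [j] increase with [d], so [d <= r] and [d >= r] are at their
    worst for [d = r]. *)
Lemma dilatation_jspace_le (x : Y) (r : R) : 0 < r < F x ->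
  (dilatation (fun x : Y => (x : jspace Fpos Flip)) x r <=
   ((F x + 2 * r) / (F x - r))%:E)%E.
Proof.
move=> /andP[r0 ra]; have a0 := Fpos x.
have ar0 : 0 < F x - r by rewrite subr_gt0.
have a2r0 : 0 < F x + 2 * r by lra.
have -> : (F x + 2 * r) / (F x - r) = (r / (F x - r)) / (r / (F x + 2 * r)).
  by field; rewrite !gt_eqF.
apply: dilatation_le; [exact: ltW|exact: divr_gt0| |] => y.
  rewrite mdist_jspace => yr; apply: (le_trans (jdist_le (le_lt_trans yr ra))).
  have ad0 : 0 < F x - mdist x y by rewrite subr_gt0 (le_lt_trans yr).
  rewrite ler_pdivrMr// mulrAC ler_pdivlMr//.
  by have := ler_wpM2r (ltW a0) yr; lra.
rewrite mdist_jspace => ry; apply: le_trans (jdist_ge x y).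
have ad0 : 0 < F x + 2 * mdist x y by lra.
rewrite ler_pdivrMr// mulrAC ler_pdivlMr//.
by have := ler_wpM2r (ltW a0) ry; lra.
Qed.

Lemma quasiconformal_jspace :
  quasiconformal 1 (fun x : Y => (x : jspace Fpos Flip)).
Proof.
split.
  split; first exact: continuous_to_jspace.
  by exists (fun x : jspace Fpos Flip => (x : Y)) => //;
    exact: continuous_from_jspace.
move=> x; apply: limf_esup_le => e e0.
have a0 := Fpos x; have e30 : 0 < 3 + e by lra.
(* This bound on the radius solves (a + 2 r) / (a - r) = 1 + e for a = F x. *)
have r00 : 0 < e * F x / (3 + e) by rewrite !mulr_gt0 ?invr_gt0.
near=> r.
have r0 : 0 < r by near: r; exact: nbhs_right_gt.
have : r < e * F x / (3 + e) by near: r; exact: nbhs_right_lt.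
rewrite ltr_pdivlMr// => rlt.
have ra : r < F x by rewrite -(ltr_pM2r e30); lra.
apply: (le_trans (dilatation_jspace_le _)); first by rewrite r0.
by rewrite lee_fin ler_pdivrMr ?subr_gt0//; lra.
Unshelve. all: by end_near. Qed.

End jdist_bounds.

Theorem theorem6 (R : realType) (X : metricType R) (M : set X)
    (M_nonempty : M !=set0) (M_proper : M != setT) (M_closed : closed M)
    (F : set_type (~` M) -> R)
    (Fpos : forall x, 0 < F x) (Flip : lipschitz1 F) :
  quasiconformal 1 (fun x : set_type (~` M) => (x : jspace Fpos Flip)).
Proof. exact: quasiconformal_jspace. Qed.
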